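(* Let $n,k\ge 1$ and let $\mathbf{C}=(C_0,C_1,\dots,C_k)$ be a $(k+1)$-tuple of real $n\times n$ matrices. Consider the statements: (i) $\mathbf{C}$ has the column $W$-property. (ii) $\mathbf{C}$ has the cS-$W$ property. (iii) $\mathbf{C}$ has the column $W_0$-property. Then (i) implies (ii), and (ii) implies (iii).
   Context: Notation: $[m]=\{1,\dots,m\}$; for $u,v\in\mathbb{R}^n$, $u*v$ is the componentwise product, and $u\ge 0$, $u\le 0$ are understood componentwise. Column representative: a matrix $R\in\mathbb{R}^{n\times n}$ is a column representative of $\mathbf{C}=(C_0,\dots,C_k)$ if for each $j\in[n]$ the $j$-th column of $R$ belongs to the set consisting of the $j$-th columns of $C_0,C_1,\dots,C_k$. Column $W$-property: the determinants of all column representatives of $\mathbf{C}$ are all positive or all negative. Column $W_0$-property: either the determinants of all column representatives of $\mathbf{C}$ are nonnegative and at least one is positive, or they are all nonpositive and at least one is negative. cS-$W$ (column sufficient-$W$) property: for all $x_0,x_1,\dots,x_k\in\mathbb{R}^n$ with $C_0x_0=\sum_{i=1}^k C_ix_i$, $x_0*x_i\le 0$ for all $i\in[k]$, and $x_i*x_j\ge 0$ for all $1\le i<j\le k$, one has $x_i*x_{i+1}=0$ for all $0\le i\le k-1$. *)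

(* Defs.v *)
From HB Require Import structures.
From mathcomp Require Import all_boot all_order all_algebra.
From mathcomp Require Import reals.

Set Implicit Arguments.
Unset Strict Implicit.
Unset Printing Implicit Defensive.

Import Order.TTheory GRing.Theory Num.Theory.

Local Open Scope ring_scope.

(* A (k+1)-tuple (C_0, ..., C_k) is a function on 'I_k.+1, with C_0 = C ord0. *)

Definition cwmul (R : realType) (n : nat) (u v : 'cV[R]_n) : 'cV[R]_n :=
  map2_mx *%R u v.

Definition cvnneg (R : realType) (n : nat) (u : 'cV[R]_n) : Prop :=
  forall j : 'I_n, 0 <= u j 0.

Definition cvnpos (R : realType) (n : nat) (u : 'cV[R]_n) : Prop :=
  forall j : 'I_n, u j 0 <= 0.

Definition column_representative (R : realType) (n k : nat)
    (C : 'I_k.+1 -> 'M[R]_n) (M : 'M[R]_n) : Prop :=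
  forall j : 'I_n, exists i : 'I_k.+1, col j M = col j (C i).

Definition column_W (R : realType) (n k : nat) (C : 'I_k.+1 -> 'M[R]_n) : Prop :=
  (forall M : 'M[R]_n, column_representative C M -> 0 < \det M) \/
  (forall M : 'M[R]_n, column_representative C M -> \det M < 0).

Definition column_W0 (R : realType) (n k : nat) (C : 'I_k.+1 -> 'M[R]_n) : Prop :=
  ((forall M : 'M[R]_n, column_representative C M -> 0 <= \det M) /\
   (exists M : 'M[R]_n, column_representative C M /\ 0 < \det M)) \/
  ((forall M : 'M[R]_n, column_representative C M -> \det M <= 0) /\
   (exists M : 'M[R]_n, column_representative C M /\ \det M < 0)).

Definition column_sufficient_W (R : realType) (n k : nat)
    (C : 'I_k.+1 -> 'M[R]_n) : Prop :=
  forall x : 'I_k.+1 -> 'cV[R]_n,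
    C ord0 *m x ord0 = \sum_(i < k.+1 | (1 <= i)%N) C i *m x i ->
    (forall i : 'I_k.+1, (1 <= i)%N -> cvnpos (cwmul (x ord0) (x i))) ->
    (forall i j : 'I_k.+1, (1 <= i)%N -> (i < j)%N ->
       cvnneg (cwmul (x i) (x j))) ->
    forall i j : 'I_k.+1, j = i.+1 :> nat -> cwmul (x i) (x j) = 0.

(* Main.v *)
Require Import Defs.
From mathcomp Require Import all_boot all_order all_algebra.
From mathcomp Require Import reals.
From mathcomp Require Import ring.

(** Give every column [j] its own family of weights [w j i], and let [colmix C w]
be the matrix whose [j]-th column is the combination of the [j]-th columns of
the [C i] with these weights.  By multilinearity of the determinant
([det_colmix]), [\det (colmix C w)] is the combination of the determinants of
the column representatives whose coefficients are the products of weights.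

After the sign change [y 0 = x 0], [y i = - x i] for [i > 0], the hypotheses on
[x] in the column sufficient property say that [\sum_i C i *m y i = 0] and that,
for each row [j], the numbers [y i j] all have the same weak sign.  Such a
family is of the form [y i j = w j i * z j] with nonnegative weights, and the
linear equation becomes [colmix C w *m z = 0].  So everything is about
singularity of mixtures of columns.

- If all representatives have determinants of one strict sign, so has every
  mixture whose weights are nonnegative and not all zero in any column.  Hence
  [z = 0], and all [x i] vanish ([column_W_aligned]).

- If a mixture with positive weights were singular, a nonzero kernel vector [z]
  would give a family with [x 0] and [x 1] both nonzero wherever [z] is, against
  column sufficiency ([sufficient_det_colmix_neq0]).  So no mixture with
  positive weights is singular.  Now compare any representative with the mixture
  whose weights are all [1]: on the segment joining them every point but the
  first has positive weights, so by the intermediate value theorem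
  ([det_segment_root]) the two determinants cannot have opposite signs.  As the
  determinant of the all-ones mixture is nonzero and is the sum of the
  determinants of all the representatives, the latter share its weak sign and
  one of them has it strictly. *)

Set Implicit Arguments.
Unset Strict Implicit.
Unset Printing Implicit Defensive.

Import Order.TTheory GRing.Theory Num.Theory.

Local Open Scope ring_scope.

(** * Column mixtures and their determinants *)

Definition colmix (R : comNzRingType) (I : finType) (n : nat)
    (C : I -> 'M[R]_n) (w : 'I_n -> I -> R) : 'M[R]_n :=
  \matrix_(r, j) \sum_i w j i * C i r j.

Definition colpick (R : comNzRingType) (I : finType) (n : nat)
    (C : I -> 'M[R]_n) (f : 'I_n -> I) : 'M[R]_n :=
  \matrix_(r, j) C (f j) r j.

Lemma colpick_colmix (R : comNzRingType) (I : finType) (n : nat)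
    (C : I -> 'M[R]_n) (f : 'I_n -> I) :
  colpick C f = colmix C (fun j i => (i == f j)%:R).
Proof.
apply/matrixP => r j; rewrite !mxE (bigD1 (f j)) //= eqxx mul1r.
by rewrite big1 ?addr0 // => i /negPf ->; rewrite mul0r.
Qed.

Lemma mul_colmix (R : comNzRingType) (I : finType) (n : nat)
    (C : I -> 'M[R]_n) (w : 'I_n -> I -> R) (z : 'cV[R]_n) :
  colmix C w *m z = \sum_i C i *m (\col_j (w j i * z j 0)).
Proof.
apply/colP => r; rewrite mxE summxE.
under eq_bigr do rewrite mxE mulr_suml.
rewrite exchange_big; apply: eq_bigr => i _.
by rewrite mxE; apply: eq_bigr => j _; rewrite !mxE; ring.
Qed.

Lemma det_colmix (R : comNzRingType) (I : finType) (n : nat)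
    (C : I -> 'M[R]_n) (w : 'I_n -> I -> R) :
  \det (colmix C w) =
  \sum_(f : {ffun 'I_n -> I}) (\prod_j w j (f j)) * \det (colpick C f).
Proof.
rewrite -det_tr [LHS]/determinant.
under eq_bigr => s _.
  under eq_bigr do rewrite !mxE.
  rewrite bigA_distr_bigA mulr_sumr; over.
rewrite exchange_big; apply: eq_bigr => f _.
rewrite -(det_tr (colpick C f)) [in RHS]/determinant mulr_sumr; apply: eq_bigr => s _.
rewrite big_split /= mulrCA; congr (_ * (_ * _)).
by apply: eq_bigr => j _; rewrite !mxE.
Qed.

Lemma det_colmix_gt0 (R : realFieldType) (I : finType) (n : nat)
    (C : I -> 'M[R]_n) (w : 'I_n -> I -> R) :
  (forall j i, 0 <= w j i) -> (forall j, exists i, 0 < w j i) ->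
  (forall f, 0 < \det (colpick C f)) -> 0 < \det (colmix C w).
Proof.
move=> w_ge0 w_gt0 detC_gt0; have [f wf_gt0] := fin_all_exists w_gt0.
rewrite det_colmix (bigD1 (finfun f)) //= ltr_pwDl //.
  by rewrite mulr_gt0 // prodr_gt0 // => j _; rewrite ffunE.
by apply: sumr_ge0 => g _; rewrite mulr_ge0 ?prodr_ge0 // ltW.
Qed.

Lemma det_colmix_lt0 (R : realFieldType) (I : finType) (n : nat)
    (C : I -> 'M[R]_n) (w : 'I_n -> I -> R) :
  (forall j i, 0 <= w j i) -> (forall j, exists i, 0 < w j i) ->
  (forall f, \det (colpick C f) < 0) -> \det (colmix C w) < 0.
Proof.
move=> w_ge0 w_gt0 detC_lt0; have [f wf_gt0] := fin_all_exists w_gt0.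
rewrite det_colmix (bigD1 (finfun f)) //= ltr_nwDl //.
  by rewrite pmulr_rlt0 // prodr_gt0 // => j _; rewrite ffunE.
by apply: sumr_le0 => g _; rewrite mulr_ge0_le0 ?prodr_ge0 // ltW.
Qed.

Lemma det0_colP (F : fieldType) (n : nat) (A : 'M[F]_n) :
  \det A = 0 <-> exists2 z : 'cV[F]_n, z != 0 & A *m z = 0.
Proof.
rewrite -det_tr; split=> [/eqP/det0P[v v_neq0 vA0]|[z z_neq0 Az0]].
  exists v^T; first by rewrite -(inj_eq trmx_inj) trmxK trmx0.
  by apply: trmx_inj; rewrite trmx_mul trmxK vA0 trmx0.
apply/eqP/det0P; exists z^T; first by rewrite -(inj_eq trmx_inj) trmxK trmx0.
by rewrite -trmx_mul Az0 trmx0.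
Qed.

(** The determinant is a polynomial along the segment, so over a real closed
field the intermediate value theorem applies to it. *)
Lemma det_segment_root (R : rcfType) (n : nat) (A B : 'M[R]_n) :
  \det A * \det B < 0 ->
  exists2 t, 0 < t < 1 & \det ((1 - t) *: A + t *: B) = 0.
Proof.
move=> detAB_lt0.
pose P : 'M[{poly R}]_n :=
  \matrix_(r, j) ((A r j)%:P + (B r j - A r j) *: 'X).
have detP t : (\det P).[t] = \det ((1 - t) *: A + t *: B).
  rewrite -[LHS]/(horner_eval t (\det P)) -det_map_mx; congr (\det _).
  by apply/matrixP => r j; rewrite !mxE /= horner_evalE !hornerE; ring.
have detP0 : (\det P).[0] = \det A by rewrite detP subr0 scale1r scale0r addr0.
have detP1 : (\det P).[1] = \det B by rewrite detP subrr scale1r scale0r add0r.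
(* Scaling by [\det B] makes the values at both ends have known signs. *)
have [||t t01 rt] := @poly_ivt _ (\det B *: \det P) 0 1; first exact: ler01.
  by rewrite !hornerZ detP0 detP1 mulrC ltW //= -expr2 sqr_ge0.
have detB_neq0 : \det B != 0.
  by apply: contraTneq detAB_lt0 => ->; rewrite mulr0 ltxx.
have detA_neq0 : \det A != 0.
  by apply: contraTneq detAB_lt0 => ->; rewrite mul0r ltxx.
have detPt0 : (\det P).[t] = 0.
  by apply/eqP; move: rt; rewrite /root hornerZ mulf_eq0 (negPf detB_neq0).
exists t; last by rewrite -detP.
case/andP: t01 => t_ge0 t_le1.
rewrite !lt_neqAle t_ge0 t_le1 !andbT; apply/andP; split.
  by apply: contra_neq detA_neq0 => t0; move: detPt0; rewrite -t0 detP0.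
by apply: contra_neq detB_neq0 => t1; move: detPt0; rewrite t1 detP1.
Qed.

(** * Column representatives *)

Lemma colpick_representative (R : realType) (n k : nat)
    (C : 'I_k.+1 -> 'M[R]_n) (f : 'I_n -> 'I_k.+1) :
  column_representative C (colpick C f).
Proof. by move=> j; exists (f j); apply/colP => r; rewrite !mxE. Qed.

Lemma representative_colpick (R : realType) (n k : nat)
    (C : 'I_k.+1 -> 'M[R]_n) (M : 'M[R]_n) :
  column_representative C M -> exists f : 'I_n -> 'I_k.+1, M = colpick C f.
Proof.
move=> /fin_all_exists[f Mf]; exists f; apply/matrixP => r j.
by have /colP/(_ r) := Mf j; rewrite !mxE.
Qed.

(** * Sign-aligned families *)

Definition aligned (R : realType) (n : nat) (I : Type) (y : I -> 'cV[R]_n) :=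
  forall i l j, 0 <= y i j 0 * y l j 0.

(** The weights are the shares of the [y i j] in their sum [z j]; where this sum
is zero all the [y i j] are, and any positive weights do. *)
Lemma aligned_weights (R : realType) (n : nat) (I : finType) (i0 : I)
    (y : I -> 'cV[R]_n) :
  aligned y ->
  exists (w : 'I_n -> I -> R) (z : 'cV[R]_n),
    [/\ forall j i, 0 <= w j i, forall j, exists i, 0 < w j i
      & forall i, y i = \col_j (w j i * z j 0)].
Proof.
move=> yy_ge0; pose z : 'cV[R]_n := \sum_i y i.
have yz_ge i j : y i j 0 * y i j 0 <= y i j 0 * z j 0.
  rewrite /z summxE mulr_sumr (bigD1 i) //= lerDl.
  by apply: sumr_ge0 => l _; apply: yy_ge0.
pose w j i := if z j 0 == 0 then 1 else y i j 0 / z j 0.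
have w_ge0 j i : 0 <= w j i.
  rewrite /w; case: eqVneq => [_|z_neq0]; first exact: ler01.
  have -> : y i j 0 / z j 0 = y i j 0 * z j 0 * (z j 0)^-1 ^+ 2 by field.
  by rewrite mulr_ge0 ?sqr_ge0 //; apply: le_trans (yz_ge i j).
exists w, z; split=> // [j|i].
  have [z0|z_neq0] := eqVneq (z j 0) 0.
    by exists i0; rewrite /w z0 eqxx ltr01.
  have w_sum1 : \sum_i w j i = 1.
    under eq_bigr do rewrite /w (negPf z_neq0).
    by rewrite -mulr_suml -summxE -/z divff.
  have [i w_gt0|w_le0] := pickP (fun i => 0 < w j i); first by exists i.
  have : \sum_i w j i <= 0.
    by apply: sumr_le0 => i _; rewrite leNgt w_le0.
  by rewrite w_sum1 ler10.
apply/colP => j; rewrite mxE /w; case: eqVneq => [z0|z_neq0]; last first.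
  by rewrite divfK.
have := yz_ge i j; rewrite z0 mulr0 mulr0 -expr2 => y2_le0.
by apply/eqP; rewrite -sqrf_eq0 eq_le y2_le0 sqr_ge0.
Qed.

Lemma column_W_aligned (R : realType) (n k : nat) (C : 'I_k.+1 -> 'M[R]_n)
    (y : 'I_k.+1 -> 'cV[R]_n) :
  column_W C -> aligned y -> \sum_i C i *m y i = 0 -> forall i, y i = 0.
Proof.
move=> CW /(aligned_weights ord0)[w [z [w_ge0 w_gt0 y_wz]]] Cy0.
have det_neq0 : \det (colmix C w) != 0.
  case: CW => CW; first apply: lt0r_neq0 (det_colmix_gt0 w_ge0 w_gt0 _) => f.
    exact/CW/colpick_representative.
  apply: ltr0_neq0 (det_colmix_lt0 w_ge0 w_gt0 _) => f.
  exact/CW/colpick_representative.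
have Cwz0 : colmix C w *m z = 0.
  by rewrite mul_colmix -[RHS]Cy0; apply: eq_bigr => i _; rewrite y_wz.
have [z0|z_neq0] := eqVneq z 0.
  by move=> i; apply/colP => j; rewrite y_wz z0 !mxE mulr0.
by move: det_neq0; rewrite (det0_colP _).2 ?eqxx //; exists z.
Qed.

(** * The sign change *)

Definition flip_tail (R : realType) (n k : nat) (x : 'I_k.+1 -> 'cV[R]_n)
    (i : 'I_k.+1) : 'cV[R]_n :=
  if i == ord0 then x i else - x i.

Lemma flip_tailE (R : realType) (n k : nat) (x : 'I_k.+1 -> 'cV[R]_n)
    (i : 'I_k.+1) :
  (1 <= i)%N -> flip_tail x i = - x i.
Proof. by rewrite /flip_tail -val_eqE /=; case: (i : nat). Qed.

Lemma flip_tailK (R : realType) (n k : nat) (x : 'I_k.+1 -> 'cV[R]_n) i :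
  flip_tail (flip_tail x) i = x i.
Proof. by rewrite /flip_tail; case: eqP => // _; rewrite opprK. Qed.

Lemma sum_flip_tail (R : realType) (n k : nat) (C : 'I_k.+1 -> 'M[R]_n)
    (x : 'I_k.+1 -> 'cV[R]_n) :
  \sum_i C i *m flip_tail x i =
  C ord0 *m x ord0 - \sum_(i < k.+1 | (1 <= i)%N) C i *m x i.
Proof.
rewrite (bigD1 ord0) //= -sumrN; congr (_ + _).
apply: eq_big => [i|i i_neq0]; first by rewrite lt0n.
by rewrite flip_tailE ?mulmxN // lt0n.
Qed.

(** The flip puts index [0] on the same footing as the others: the two sign
conditions on [x] merge into one that is symmetric in all the indices. *)
Lemma flip_tail_aligned (R : realType) (n k : nat) (x : 'I_k.+1 -> 'cV[R]_n) :
  aligned (flip_tail x) <->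
  (forall i : 'I_k.+1, (1 <= i)%N -> cvnpos (cwmul (x ord0) (x i))) /\
  (forall i j : 'I_k.+1, (1 <= i)%N -> (i < j)%N ->
     cvnneg (cwmul (x i) (x j))).
Proof.
split=> [al|[x0_le0 x_ge0] i l j].
  split=> [i i_gt0 j|i l i_gt0 lt_il j].
    have := al ord0 i j; rewrite (flip_tailE _ i_gt0) /flip_tail eqxx !mxE.
    by rewrite mulrN oppr_ge0.
  have := al i l j.
  by rewrite !flip_tailE ?(ltn_trans i_gt0 lt_il) // !mxE mulrNN.
have x0_sgn (m : 'I_k.+1) : m != ord0 -> x ord0 j 0 * x m j 0 <= 0.
  by rewrite -val_eqE -lt0n => /x0_le0/(_ j); rewrite mxE.
have x_sgn (a b : 'I_k.+1) : a != ord0 -> (a < b)%N -> 0 <= x a j 0 * x b j 0.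
  by rewrite -val_eqE -lt0n => /x_ge0/[apply]/(_ j); rewrite mxE.
rewrite /flip_tail; have [->|i_neq0] := eqVneq i ord0.
  have [->|l_neq0] := eqVneq l ord0; first by rewrite -expr2 sqr_ge0.
  by rewrite mxE mulrN oppr_ge0 x0_sgn.
have [->|l_neq0] := eqVneq l ord0.
  by rewrite mxE mulNr oppr_ge0 mulrC x0_sgn.
rewrite !mxE mulrNN; have [lt_il|lt_li|/val_inj ->] := ltngtP i l.
- exact: x_sgn.
- by rewrite mulrC x_sgn.
- by rewrite -expr2 sqr_ge0.
Qed.

Lemma column_W_sufficient (R : realType) (n k : nat) (C : 'I_k.+1 -> 'M[R]_n) :
  column_W C -> column_sufficient_W C.
Proof.
move=> CW x Cx x0_le0 x_ge0 i l _.
have y0 : forall m, flip_tail x m = 0.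
  apply: (column_W_aligned CW); first exact/flip_tail_aligned.
  by rewrite sum_flip_tail Cx subrr.
have -> : x i = 0 by rewrite -flip_tailK [LHS]/flip_tail y0 oppr0 if_same.
by apply/colP => j; rewrite !mxE mul0r.
Qed.

(** * Column sufficiency *)

(** A kernel vector [z] of the mixture yields the aligned family
[y i j = w j i * z j]; positivity of the weights makes [y 0] and [y 1] nonzero
together at any row where [z] is. *)
Lemma sufficient_det_colmix_neq0 (R : realType) (n k : nat)
    (C : 'I_k.+1 -> 'M[R]_n) (w : 'I_n -> 'I_k.+1 -> R) :
  (1 <= k)%N -> column_sufficient_W C -> (forall j i, 0 < w j i) ->
  \det (colmix C w) != 0.
Proof.
move=> k_gt0 CS w_gt0; apply/eqP => /det0_colP[z z_neq0].
rewrite mul_colmix; set y := fun i => \col_j (w j i * z j 0) => Cy0.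
have y_al : aligned (flip_tail (flip_tail y)).
  move=> i l j; rewrite !flip_tailK !mxE mulrACA.
  by rewrite mulr_ge0 -?expr2 ?sqr_ge0 // mulr_ge0 // ltW.
have [y0_le0 y_ge0] := (flip_tail_aligned _).1 y_al.
have Cx : C ord0 *m flip_tail y ord0 =
    \sum_(i < k.+1 | (1 <= i)%N) C i *m flip_tail y i.
  apply/eqP; rewrite -subr_eq0 -sum_flip_tail -[eqbRHS]Cy0; apply/eqP.
  by apply: eq_bigr => i _; rewrite flip_tailK.
pose i1 : 'I_k.+1 := Ordinal (k_gt0 : (1 < k.+1)%N).
have y01 := CS _ Cx y0_le0 y_ge0 ord0 i1 erefl.
case/negP: z_neq0; apply/eqP/colP => j; rewrite mxE; apply/eqP.
have /colP/(_ j)/eqP := y01; rewrite (@flip_tailE _ _ _ _ i1) // /flip_tail eqxx !mxE.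
by rewrite mulrN oppr_eq0 !mulf_eq0 !(gt_eqF (w_gt0 _ _)) orbb.
Qed.

Lemma sufficient_column_W0 (R : realType) (n k : nat) (C : 'I_k.+1 -> 'M[R]_n) :
  (1 <= k)%N -> column_sufficient_W C -> column_W0 C.
Proof.
move=> k_gt0 CS; pose D := \det (colmix C (fun _ _ => 1)).
have mix_neq0 := sufficient_det_colmix_neq0 k_gt0 CS.
have pick_sgn f : 0 <= \det (colpick C f) * D.
  rewrite leNgt; apply/negP => /det_segment_root[t /andP[t_gt0 t_lt1]].
  (* The segment runs through mixtures whose weights are at least [t]. *)
  have -> : (1 - t) *: colpick C f + t *: colmix C (fun _ _ => 1) =
      colmix C (fun j i => (1 - t) * (i == f j)%:R + t).
    rewrite colpick_colmix; apply/matrixP => r j; rewrite !mxE !mulr_sumr.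
    by rewrite -big_split; apply: eq_bigr => i _ /=; ring.
  apply/eqP/mix_neq0 => j i; rewrite ltr_wpDl // mulr_ge0 ?ler0n //.
  by rewrite subr_ge0 ltW.
have D_sum : D = \sum_(f : {ffun 'I_n -> 'I_k.+1}) \det (colpick C f).
  by rewrite /D det_colmix; apply: eq_bigr => f _; rewrite big1_eq mul1r.
have : D != 0 by apply: mix_neq0 => _ _; exact: ltr01.
rewrite neq_lt => /orP[D_lt0|D_gt0]; [right|left]; split.
- by move=> M /representative_colpick[f ->]; rewrite -(nmulr_lge0 _ D_lt0).
- have [f f_lt0|f_ge0] :=
      pickP (fun f : {ffun 'I_n -> 'I_k.+1} => \det (colpick C f) < 0).
    by exists (colpick C f); split=> //; apply: colpick_representative.
  move: D_lt0; rewrite ltNge D_sum sumr_ge0 // => f _.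
  by rewrite leNgt f_ge0.
- by move=> M /representative_colpick[f ->]; rewrite -(pmulr_lge0 _ D_gt0).
- have [f f_gt0|f_le0] :=
      pickP (fun f : {ffun 'I_n -> 'I_k.+1} => 0 < \det (colpick C f)).
    by exists (colpick C f); split=> //; apply: colpick_representative.
  move: D_gt0; rewrite ltNge D_sum sumr_le0 // => f _.
  by rewrite leNgt f_le0.
Qed.

Theorem theorem4p3 (R : realType) (n k : nat) (hn : (1 <= n)%N) (hk : (1 <= k)%N)
    (C : 'I_k.+1 -> 'M[R]_n) :
  (column_W C -> column_sufficient_W C) /\
  (column_sufficient_W C -> column_W0 C).
Proof.
split; first exact: column_W_sufficient.
exact: sufficient_column_W0.
Qed.
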